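(* For all integers $c\ge1$ and $n\ge0$, $$I_{c,n}=\frac{c^n n!}{2}\left(c\binom{n+1}{2}-n\right).$$
   Context: For integers $n\ge0$, $c\ge1$, let $G_{c,n}$ be the set of colored permutations: words $\sigma=\sigma_1^{[c_1]}\cdots\sigma_n^{[c_n]}$ where $|\sigma|=\sigma_1\cdots\sigma_n$ is a permutation of $[n]$ and each color $c_i\in\{0,\dots,c-1\}$ (for $n=0$, $G_{c,0}$ consists of the empty word). For a permutation $\pi$ of $[n]$, $\mathrm{inv}(\pi)=|\{(i,j):i<j,\ \pi_i>\pi_j\}|$. Let $\mathrm{col}(\sigma)=c_1+\cdots+c_n$ and $\mathrm{inv}_c(\sigma)=\mathrm{inv}(|\sigma|)+\mathrm{col}(\sigma)+c\cdot|\{(i,j):1\le i<j\le n,\ \sigma_i<\sigma_j,\ c_j\ne0\}|$. Let $I_{c,n}=\sum_{\sigma\in G_{c,n}}\mathrm{inv}_c(\sigma)$. *)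

(* Defs.v *)
From mathcomp Require Import all_boot all_fingroup.

Set Implicit Arguments.
Unset Strict Implicit.
Unset Printing Implicit Defensive.

(* Positions, letters and colors are all numbered from 0: the pair (p, k)
   encodes the word whose letter at position i is (p i).+1, with color k i.
   The shift by one is harmless, as letters are only compared to each other. *)
Notation colored_perm c n := ('S_n * {ffun 'I_n -> 'I_c})%type.

Definition abs_perm (c n : nat) (s : colored_perm c n) : 'S_n := s.1.

Definition color (c n : nat) (s : colored_perm c n) (i : 'I_n) : 'I_c := s.2 i.

Definition inv_perm (n : nat) (p : 'S_n) : nat :=
  #|[set ij : 'I_n * 'I_n | (ij.1 < ij.2) && (p ij.1 > p ij.2)]|.

Definition col (c n : nat) (s : colored_perm c n) : nat :=
  \sum_(i < n) color s i.

Definition inv_colored (c n : nat) (s : colored_perm c n) : nat :=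
  inv_perm (abs_perm s) + col s +
  c * #|[set ij : 'I_n * 'I_n |
          [&& ij.1 < ij.2, abs_perm s ij.1 < abs_perm s ij.2
            & color s ij.2 != 0 :> nat]]|.

Definition total_inv (c n : nat) : nat :=
  \sum_(s : colored_perm c n) inv_colored s.

(* Main.v *)
(** By linearity, each pair of positions [i < j] and each color can be averaged
    separately over uniformly random colored permutations: complementing the
    letters shows that [i < j] is an inversion half of the time, and the color
    at [j] is uniform and independent of the letters.  So a pair contributes
    [1/2 + c * (1/2) * (c-1)/c = c/2] and a position [(c-1)/2]. *)

Require Import Defs.
From HB Require Import structures.
From mathcomp Require Import all_boot all_order all_algebra all_fingroup.
From mathcomp Require Import ring.

Set Implicit Arguments.
Unset Strict Implicit.
Unset Printing Implicit Defensive.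

Import GRing.Theory.
Local Open Scope ring_scope.

Lemma card_ltn_pairs (n : nat) :
  #|[set ij : 'I_n * 'I_n | (ij.1 < ij.2)%N]| = 'C(n, 2).
Proof.
rewrite cardsE -sum1_card -bin2_sum big_mkord.
rewrite -(pair_big_dep xpredT (fun i j : 'I_n => (i < j)%N) (fun _ _ => 1%N)) /=.
rewrite (exchange_big_dep xpredT) //=; apply: eq_bigr => j _.
rewrite -(big_ord_widen_cond n xpredT (fun=> 1%N)); last exact/ltnW.
by rewrite sum1_card card_ord.
Qed.

Lemma sum_perm_ltn (n : nat) (i j : 'I_n) : i != j ->
  (2 * \sum_(p : 'S_n) (p i < p j) = n`!)%N.
Proof.
move=> ij; rewrite mul2n -addnn.
(* Complementing the letters reverses every comparison, so after reindexing one copy of the sum,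
   each permutation counts exactly once in the two copies together. *)
pose compl (p : 'S_n) : 'S_n := (p * perm (@rev_ord_inj n))%g.
rewrite [X in (X + _)%N](reindex_inj (h := compl)); last exact: mulIg.
rewrite -big_split -card_Sn -sum1_card; apply: eq_bigr => p _ /=.
have /negPf pij : p i != p j :> nat by rewrite (inj_eq val_inj) (inj_eq perm_inj).
rewrite !permM !permE /= ltn_sub2lE ?ltnS //.
by case: ltngtP pij.
Qed.

(** The other [n.-1] colors are free; the factor [c] on the left turns [c ^ n.-1] into [c ^ n]. *)
Lemma sum_ffun_at (c n : nat) (j : 'I_n) (g : 'I_c -> nat) :
  (c * \sum_(k : {ffun 'I_n -> 'I_c}) g (k j) = c ^ n * \sum_x g x)%N.
Proof.
(* Padding with factors 1 makes the summand a product over all positions, so the sum over colorings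
   factors. *)
pose F i x := if i == j then g x else 1%N.
have -> : (\sum_(k : {ffun 'I_n -> 'I_c}) g (k j) =
           \sum_(k : {ffun 'I_n -> 'I_c}) \prod_i F i (k i))%N.
  apply: eq_bigr => k _; rewrite (bigD1 j) //= /F eqxx big1 ?muln1 //.
  by move=> i /negPf ->.
rewrite -bigA_distr_bigA (bigD1 j) //= {1}/F eqxx.
have -> : (\prod_(i < n | i != j) \sum_x F i x = c ^ n.-1)%N.
  rewrite -[in RHS](card_ord n) -(cardC1 j) -prod_nat_const.
  by apply: eq_bigr => i /negPf nij; rewrite /F nij sum1_card card_ord.
have n_gt0 : (0 < n)%N by apply: leq_ltn_trans (ltn_ord j).
by rewrite -[in RHS](prednK n_gt0) expnS; ring.
Qed.

(** Independence of the letters and the color at [j]. *)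
Lemma sum_colored_perm (c n : nat) (j : 'I_n) (f : 'S_n -> nat)
    (g : 'I_c -> nat) :
  (c * \sum_(s : colored_perm c n) f s.1 * g (s.2 j) =
   (\sum_p f p) * (c ^ n * \sum_x g x))%N.
Proof.
rewrite -(sum_ffun_at j) mulnCA; congr (c * _)%N.
rewrite big_distrlr /=.
by rewrite (pair_bigA _ (fun p (k : {ffun 'I_n -> 'I_c}) => f p * g (k j)))%N.
Qed.

Lemma sum_color (c n : nat) (j : 'I_n) : (0 < c)%N ->
  (2 * \sum_(s : colored_perm c n) color s j = c ^ n * n`! * c.-1)%N.
Proof.
move=> c_gt0; apply/eqP; rewrite -(eqn_pmul2l c_gt0); apply/eqP.
have colors : (c * \sum_(s : colored_perm c n) color s j =
               n`! * (c ^ n * 'C(c, 2)))%N.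
  rewrite -card_Sn -sum1_card -bin2_sum big_mkord -(sum_colored_perm j).
  by under [in RHS]eq_bigr do rewrite mul1n.
rewrite [LHS]mulnCA colors.
(* This is [c * c.-1 = 2 * 'C(c, 2)]. *)
have := mul_bin_diag c 1; rewrite bin1 => c2.
transitivity (c ^ n * n`! * (2 * 'C(c, 2)))%N; first by ring.
by rewrite -c2; ring.
Qed.

Lemma sum_inv_colored_pair (c n : nat) (i j : 'I_n) : (0 < c)%N -> i != j ->
  (2 * \sum_(s : colored_perm c n)
     ((abs_perm s j < abs_perm s i) +
      c * ((abs_perm s i < abs_perm s j) && (color s j != 0 :> nat))) =
   c ^ n * n`! * c)%N.
Proof.
move=> c_gt0 ij; rewrite big_split /= -big_distrr /=.
under [X in (_ + _ * X)%N]eq_bigr do rewrite -mulnb.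
(* The weight [c] in the statistic is exactly the factor that independence requires. *)
rewrite (sum_colored_perm j (fun p => p i < p j)%N
          (fun x => x != 0 :> nat)%N).
have -> : (\sum_(x < c) (x != 0 :> nat) = c.-1)%N.
  case: c c_gt0 => // c _; rewrite big_ord_recl /= add0n.
  by rewrite sum1_card card_ord.
have inversions : (2 * \sum_(s : colored_perm c n)
    (abs_perm s j < abs_perm s i) = c ^ n * n`!)%N.
  apply/eqP; rewrite -(eqn_pmul2l c_gt0); apply/eqP.
  (* Inversions ignore colors, hence the constant weight 1. *)
  have := sum_colored_perm j (fun p => p j < p i)%N (fun _ : 'I_c => 1%N).
  under [X in (c * X)%N]eq_bigr do rewrite muln1.
  rewrite sum1_card card_ord [(c * (2 * _))%N]mulnCA => ->.
  by rewrite mulnA sum_perm_ltn 1?eq_sym //; ring.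
rewrite mulnDr inversions mulnA sum_perm_ltn //.
by rewrite -[X in _ = (_ * X)%N](prednK c_gt0); ring.
Qed.

(** Indexing both cardinals by the same pairs prepares the exchange of sums. *)
Lemma inv_coloredE (c n : nat) (s : colored_perm c n) :
  (inv_colored s =
   \sum_(ij : 'I_n * 'I_n | ij.1 < ij.2)
     ((abs_perm s ij.2 < abs_perm s ij.1) +
      c * ((abs_perm s ij.1 < abs_perm s ij.2) && (color s ij.2 != 0 :> nat)))
   + \sum_(j < n) color s j)%N.
Proof.
rewrite /inv_colored /inv_perm /col big_split /= -big_distrr /= addnAC.
by congr (_ + _ * _ + _)%N; rewrite cardsE -sum1_card big_mkcondr;
   apply: eq_bigr => ij _; case: ifP.
Qed.

Lemma double_total_inv (c n : nat) : (0 < c)%N ->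
  (2 * total_inv c n = c ^ n * n`! * (c * 'C(n, 2) + c.-1 * n))%N.
Proof.
move=> c_gt0; rewrite /total_inv.
under eq_bigr do rewrite inv_coloredE.
rewrite big_split /= exchange_big /= [X in (_ + X)%N]exchange_big /=.
rewrite mulnDr !big_distrr /=.
under eq_bigr => ij lt_ij.
  rewrite sum_inv_colored_pair //; last by rewrite neq_ltn lt_ij.
  over.
under [X in (_ + X)%N]eq_bigr do rewrite sum_color //.
rewrite !sum_nat_const card_ord -cardsE card_ltn_pairs.
by ring.
Qed.

Theorem theorem3p8 (c n : nat) (hc : (1 <= c)%N) :
  (total_inv c n)%:R =
    (c ^ n * n`!)%:R / 2%:R * (c%:R * 'C(n.+1, 2)%:R - n%:R) :> rat.
Proof.
have : ((2 * total_inv c n)%:R =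
        (c ^ n * n`! * (c * 'C(n, 2) + c.-1 * n))%:R :> rat).
  by rewrite double_total_inv.
(* Pascal's rule gives ['C(n.+1, 2) = 'C(n, 2) + n]; writing [c] as [c.-1.+1] leaves [c.-1] as the
   only unknown for the color count. *)
rewrite binS bin1 -[in c%:R](prednK hc) -[in (c * _)%N](prednK hc).
move: (c ^ n * n`!)%N => N.
rewrite !(natrM, natrD, mulrSr) => double.
by field: double.
Qed.
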